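(* Let $n\ge 1$ and let $P_n$ be a labeled path on $n$ vertices. Then the chromatic quasisymmetric function $X(P_n;\mathbf{x},q)$ is symmetric if and only if $P_n$ has the natural labeling.
   Context: A labeled graph is a finite simple graph $G=(V,E)$ with vertex set $V=[n]=\{1,\dots,n\}$. A proper coloring is a map $c\colon[n]\to\mathbb{P}=\{1,2,\dots\}$ with $c(i)\neq c(j)$ whenever $ij\in E$. Its ascent set is $\operatorname{Asc}(c)=\{ij\in E : i<j,\ c(i)<c(j)\}$ and $\operatorname{asc}(c)=\#\operatorname{Asc}(c)$. The chromatic quasisymmetric function (CQF) is $X(G;\mathbf{x},q)=\sum_{c}x_{c(1)}x_{c(2)}\cdots x_{c(n)}\,q^{\operatorname{asc}(c)}$, summed over proper colorings $c$; it is a polynomial in $q$ whose coefficients are quasisymmetric functions. It is called symmetric if every coefficient of $q^k$ is a symmetric function. A labeled path $P_n$ is the path graph with vertices $v_1,\dots,v_n$ (edges $v_iv_{i+1}$, $1\le i\le n-1$) where $v_i$ carries label $\sigma_i$ for a permutation $\sigma=\sigma_1\cdots\sigma_n$ of $[n]$ (vertices are identified with their labels). The natural labeling is $\sigma=12\cdots n$ or $\sigma=n\cdots 21$. *)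

(* Defs.v *)
From mathcomp Require Import all_boot all_order all_fingroup.
Set Implicit Arguments. Unset Strict Implicit. Unset Printing Implicit Defensive.

(* Vertices of a graph on [n] are 'I_n; label i+1 is represented by i : 'I_n
   (order preserved).  A graph is a relation e : rel 'I_n (assumed simple). *)

(* Colorings with colors in {1,..,N}: c : {ffun 'I_n -> 'I_N}, color m : 'I_N
   standing for the positive integer m+1 (order preserved). *)

Definition proper (n N : nat) (e : rel 'I_n) (c : {ffun 'I_n -> 'I_N}) : bool :=
  [forall i, forall j, e i j ==> (c i != c j)].

Definition asc (n N : nat) (e : rel 'I_n) (c : {ffun 'I_n -> 'I_N}) : nat :=
  #|[set ij : 'I_n * 'I_n | [&& e ij.1 ij.2, (ij.1 < ij.2)%N & (c ij.1 < c ij.2)%N]]|.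

(* the monomial x_{c(1)} ... x_{c(n)} equals x_1^{a_1} ... x_N^{a_N} *)
Definition has_content (n N : nat) (c : {ffun 'I_n -> 'I_N}) (a : {ffun 'I_N -> nat}) : bool :=
  [forall m : 'I_N, #|[set i | c i == m]| == a m].

(* Coefficient of q^k x_1^{a_1} ... x_N^{a_N} in the chromatic quasisymmetric
   function X(G; x, q) (in infinitely many variables x_1, x_2, ...): only
   colorings using colors among 1..N contribute to such a monomial. *)
Definition cqf_coef (n : nat) (e : rel 'I_n) (k N : nat) (a : {ffun 'I_N -> nat}) : nat :=
  #|[set c : {ffun 'I_n -> 'I_N} | [&& proper e c, asc e c == k & has_content c a]]|.

(* X(G;x,q) is symmetric: every coefficient of q^k is a symmetric function,
   i.e. its monomial coefficients are invariant under permuting the variables.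
   (Any rearrangement of a finitely supported exponent vector is realised by a
   permutation of some initial segment {1..N} of the variables.) *)
Definition cqf_symmetric (n : nat) (e : rel 'I_n) : Prop :=
  forall (k N : nat) (a : {ffun 'I_N -> nat}) (s : 'S_N),
    cqf_coef e k a = cqf_coef e k [ffun m => a (s m)].

(* Labeled path P_n: vertices v_1..v_n with v_p carrying label sigma_p;
   edges between the labels of consecutive vertices. *)
Definition path_rel (n : nat) (sigma : 'S_n) : rel 'I_n :=
  fun i j => [exists p : 'I_n, exists p' : 'I_n,
    (val p' == (val p).+1) &&
    (((sigma p == i) && (sigma p' == j)) || ((sigma p == j) && (sigma p' == i)))].

Definition natural_labeling (n : nat) (sigma : 'S_n) : Prop :=
  sigma = 1%g \/ (forall i : 'I_n, sigma i = rev_ord i).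

(* Main.v *)
(* A coloring read along the path is a word [w], an edge being an ascent iff the colors compare
   like the labels; only the up/down pattern [u] of the labels matters.

   If [u] is constant, the generating function of the words is built letter by letter, and
   invariance under exchanging two adjacent variables follows by induction on the length. The
   same holds when only some of the edges (the active ones) impose conditions.

   Conversely, look at the top power of [q]: it counts the words all of whose steps follow [u],
   i.e. the strict order-preserving colorings of a fence poset [P]. By symmetry a color class may
   be moved to the smallest or largest color, so its size is at most the number of valleys and at
   most the number of peaks of [u]. Suitable classes show that both ends of [u] agree, and that a
   pattern starting upwards has no two consecutive descents. Dropping the descents from [P] then
   leaves a disjoint union [P'] of chains having the same minima, whose colorings are also counted
   by a symmetric function. If the smallest color is used on all minima, the colorings of [P] and
   [P'] are the same; by symmetry this persists for any color class of that size, which is absurd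
   as soon as there is a descent: its two ends may get the same color in [P']. *)
Require Import Defs.
From mathcomp Require Import all_boot all_order all_fingroup.
From mathcomp Require Import ssralg ssrnum ssrint poly mpoly ring zify.

Set Implicit Arguments. Unset Strict Implicit. Unset Printing Implicit Defensive.
Import GRing.Theory Num.Theory.

(** * Words with active steps and their generating function *)

Definition word_proper (n N : nat) (act : pred nat) (w : {ffun 'I_n.+1 -> 'I_N}) :=
  [forall i : 'I_n, act i ==> (w (inord i) != w (inord i.+1))].

Definition word_asc (n N : nat) (act : pred nat) (w : {ffun 'I_n.+1 -> 'I_N}) :=
  #|[set i : 'I_n | act i && (w (inord i) < w (inord i.+1))]|.

Definition word_coef (n : nat) (act : pred nat) (k N : nat) (a : {ffun 'I_N -> nat}) :=
  #|[set w : {ffun 'I_n.+1 -> 'I_N} |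
      [&& word_proper act w, word_asc act w == k & has_content w a]]|.

Local Open Scope ring_scope.

(* [b] tells whether the step from [c] to [d] is active. *)
Definition step_weight (R : comNzRingType) (N : nat) (q : R) (b : bool) (c d : 'I_N) : R :=
  if b then (if (c < d)%N then q else (c != d)%:R) else 1.

(** Runs over the words with first letter [c] and [n] further letters. Taking [act] on all of [nat]
    makes removal of the first letter the plain shift [act \o succn]. *)
Fixpoint word_gf (R : comNzRingType) (N : nat) (q : R) (x : 'I_N -> R)
    (n : nat) (act : pred nat) (c : 'I_N) : R :=
  if n is n'.+1 then
    x c * \sum_d step_weight q (act 0%N) c d * word_gf q x n' (act \o succn) d
  else x c.

Lemma eq_word_gf (R : comNzRingType) (N : nat) (q : R) (x y : 'I_N -> R)
    (n : nat) (act : pred nat) (c : 'I_N) :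
  x =1 y -> word_gf q x n act c = word_gf q y n act c.
Proof.
move=> xy; elim: n act c => [|n IH] act c /=; first exact: xy.
by rewrite xy; congr (_ * _); apply: eq_bigr => d _; rewrite IH.
Qed.

Lemma sum_bigD2 (R : comNzRingType) (N : nat) (lo hi : 'I_N) (F : 'I_N -> R) :
  lo != hi -> \sum_d F d = F lo + F hi + \sum_(d | (d != lo) && (d != hi)) F d.
Proof.
by move=> nlh; rewrite (bigD1 lo) //= (bigD1 hi) /= ?addrA // eq_sym.
Qed.

(* With [A = word_gf lo] and [B = word_gf hi], neither [A] nor [B] is symmetric in the two
   variables; [A + B] and [q x_lo B + x_hi A] are, and each is expressed by the recursion
   through the two quantities one step earlier. *)
Lemma word_gf_swap (R : comNzRingType) (N : nat) (q : R) (x : 'I_N -> R)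
    (lo hi : 'I_N) (n : nat) (act : pred nat) :
  hi = lo.+1 :> nat ->
  let H := word_gf q x n act in
  let H' := word_gf q (x \o tperm lo hi) n act in
  [/\ H' lo + H' hi = H lo + H hi,
      x hi * q * H' hi + x lo * H' lo = x lo * q * H hi + x hi * H lo
    & forall c, c != lo -> c != hi -> H' c = H c].
Proof.
move=> hE; have nlh : lo != hi by rewrite -val_eqE /=; lia.
have nhl : hi != lo by rewrite eq_sym.
elim: n act => [|n IH] act H H'.
  rewrite /H /H' /= tpermL tpermR; split; [ring|ring|].
  by move=> c c1 c2; rewrite tpermD // eq_sym.
have := IH (act \o succn); rewrite /H /H' /= => -[].
set G := word_gf q x n _; set G' := word_gf q _ n _ => e1 e2 e3.
have sumE b c : c != lo -> c != hi ->
    \sum_d step_weight q b c d * G' d = \sum_d step_weight q b c d * G d.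
  move=> c1 c2; rewrite !(sum_bigD2 _ nlh); congr (_ + _); last first.
    by apply: eq_bigr => d /andP[d1 d2]; rewrite e3.
  (* Since [lo] and [hi] are adjacent, any third color compares in the same way with both; only the
     sum of the two values matters. *)
  have -> : step_weight q b c hi = step_weight q b c lo.
    rewrite /step_weight -!val_eqE /=; case: b => //.
    move: c1 c2; rewrite -!val_eqE /= hE => c1 c2.
    by rewrite (negbTE c1) (negbTE c2) ltnS leq_eqVlt (negbTE c1).
  by rewrite -!mulrDr e1.
pose S b := \sum_(d | (d != lo) && (d != hi)) step_weight q b lo d * G d.
(* Stated for a general [K] to serve both [G] and [G'], which agree off [lo] and [hi]. The remainder
   [S b] is the same after [lo] and after [hi], again by adjacency. *)
have restE b (K : 'I_N -> R) (eK : forall d, d != lo -> d != hi -> K d = G d) :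
    \sum_d step_weight q b lo d * K d = (if b then q * K hi else K lo + K hi) + S b
  /\ \sum_d step_weight q b hi d * K d = (if b then K lo else K lo + K hi) + S b.
  split; rewrite (sum_bigD2 _ nlh); congr (_ + _).
  - rewrite /step_weight; case: b; rewrite ?mul1r // ltnn eqxx hE ltnSn /=; ring.
  - by apply: eq_bigr => d /andP[d1 d2]; rewrite eK.
  - rewrite /step_weight; case: b; rewrite ?mul1r // ltnn eqxx nhl hE ltnNge leqnSn /=; ring.
  - apply: eq_bigr => d /andP[d1 d2]; rewrite eK //; congr (_ * _).
    rewrite /step_weight; case: b => //.
    rewrite [hi == d]eq_sym [lo == d]eq_sym d1 d2 hE; congr (if _ then _ else _).
    by move: d1 d2; rewrite -!val_eqE /=; lia.
have [-> ->] := restE (act 0%N) G (fun _ _ _ => erefl).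
have [-> ->] := restE (act 0%N) G' e3.
rewrite tpermL tpermR; split.
- case: (act 0%N); last by rewrite e1; ring.
  transitivity (x hi * q * G' hi + x lo * G' lo + (x lo + x hi) * S true); first ring.
  by rewrite e2; ring.
- case: (act 0%N); last by rewrite e1; ring.
  transitivity (x lo * x hi * (q * (G' lo + G' hi) + (q + 1) * S true)); first ring.
  by rewrite e1; ring.
- move=> c c1 c2; rewrite sumE // tpermD // eq_sym //.
Qed.

Lemma sum_word_gf_swap (R : comNzRingType) (N : nat) (q : R) (x : 'I_N -> R)
    (lo hi : 'I_N) (n : nat) (act : pred nat) :
  hi = lo.+1 :> nat ->
  \sum_c word_gf q (x \o tperm lo hi) n act c = \sum_c word_gf q x n act c.
Proof.
move=> hE; have nlh : lo != hi by rewrite -val_eqE /=; lia.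
have [/= e1 _ e3] := word_gf_swap q x n act hE.
by rewrite !(sum_bigD2 _ nlh) e1; congr (_ + _); apply: eq_bigr => d /andP[]; apply: e3.
Qed.

(** * Expansion over words and symmetry of the coefficients *)

Lemma big_tuple_cons (R : nmodType) (T : finType) (n : nat) (F : seq T -> R) :
  \sum_(t : n.+1.-tuple T) F t = \sum_c \sum_(t : n.-tuple T) F (c :: t).
Proof.
rewrite pair_big /= (reindex (fun p : T * n.-tuple T => [tuple of p.1 :: p.2])) //=.
exists (fun t => (thead t, [tuple of behead t])) => [[c t]|t] _ /=.
  by congr (_, _); apply: val_inj.
by rewrite -tuple_eta.
Qed.

Lemma word_gf_tuple (R : comNzRingType) (N : nat) (q : R) (x : 'I_N -> R)
    (n : nat) (act : pred nat) (c : 'I_N) :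
  word_gf q x n act c =
  \sum_(t : n.-tuple 'I_N) (\prod_(i < n.+1) x (nth c (c :: t) i)) *
     \prod_(i < n) step_weight q (act i) (nth c (c :: t) i) (nth c (c :: t) i.+1).
Proof.
elim: n act c => [|n IH] act c.
  rewrite (big_pred1 [tuple]) => [|t]; last first.
    by apply/esym/eqP/val_inj; rewrite [t]tuple0.
  by rewrite big_ord1 big_ord0 mulr1.
rewrite (big_tuple_cons n (fun s => (\prod_(i < n.+2) x (nth c (c :: s) i)) *
     \prod_(i < n.+1) step_weight q (act i) (nth c (c :: s) i) (nth c (c :: s) i.+1))) /=.
rewrite mulr_sumr; apply: eq_bigr => d _.
rewrite IH !mulr_sumr; apply: eq_bigr => t _.
rewrite [in RHS]big_ord_recl [X in _ = _ * X]big_ord_recl /=.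
(* The recursion changes the default of [nth] from [c] to [d], which is harmless as all indices are
   in range. *)
have nthE i : (i < n.+1)%N -> nth d (d :: t) i = nth c (d :: t) i.
  by move=> hi; apply: set_nth_default; rewrite /= size_tuple.
rewrite (eq_bigr (fun i : 'I_n.+1 => x (nth c (d :: t) i))); last first.
  by move=> i _; rewrite nthE.
rewrite (eq_bigr (fun i : 'I_n => step_weight q ((act \o succn) i)
          (nth c (d :: t) i) (nth c t i))); last first.
  move=> i _; rewrite nthE; last by rewrite ltnW // ltnS.
  by rewrite (set_nth_default c) // size_tuple.
rewrite !mulrA /=; congr (_ * _); ring.
Qed.

Lemma sum_word_gf (R : comNzRingType) (N : nat) (q : R) (x : 'I_N -> R)
    (n : nat) (act : pred nat) :
  \sum_c word_gf q x n act c =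
  \sum_(w : {ffun 'I_n.+1 -> 'I_N}) (\prod_i x (w i)) *
     \prod_(i < n) step_weight q (act i) (w (inord i)) (w (inord i.+1)).
Proof.
(* The first letter is the default of [nth]; the value on the empty sequence is never reached. *)
pose F (s : seq 'I_N) := if s is c :: _ then (\prod_(i < n.+1) x (nth c s i)) *
     \prod_(i < n) step_weight q (act i) (nth c s i) (nth c s i.+1) else 0.
transitivity (\sum_(t : n.+1.-tuple 'I_N) F t).
  by rewrite big_tuple_cons; apply: eq_bigr => c _; rewrite word_gf_tuple.
rewrite (reindex (fun w : {ffun 'I_n.+1 -> 'I_N} => [tuple w i | i < n.+1])); last first.
  exists (fun t => [ffun i => tnth t i]) => [w|t] _.
    by apply/ffunP => i; rewrite ffunE tnth_mktuple.
  by apply: eq_from_tnth => i; rewrite tnth_mktuple ffunE.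
apply: eq_bigr => w _.
have nthE c i : (i < n.+1)%N -> nth c [tuple w i | i < n.+1] i = w (inord i).
  by move=> hi; rewrite -[i in LHS](inordK hi) -tnth_nth tnth_mktuple.
rewrite /F; move: nthE; case: [tuple _ | _ < _] => -[|c s] // ? nthE; simpl tval in nthE |- *.
congr (_ * _); apply: eq_bigr => i _; first by rewrite nthE // inord_val.
by rewrite !nthE ?ltnS ?ltn_ord // (ltnW (ltn_ord i)).
Qed.

Lemma prod_step_weight (R : comNzRingType) (N : nat) (q : R)
    (n : nat) (act : pred nat) (w : {ffun 'I_n.+1 -> 'I_N}) :
  \prod_(i < n) step_weight q (act i) (w (inord i)) (w (inord i.+1)) =
  (word_proper act w)%:R * q ^+ word_asc act w.
Proof.
rewrite (eq_bigr (fun i : 'I_n => (act i ==> (w (inord i) != w (inord i.+1)))%:R *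
    (if act i && (w (inord i) < w (inord i.+1))%N then q else 1))); last first.
  move=> i _; rewrite /step_weight; case: (act i) => /=; last by rewrite mul1r.
  by rewrite -val_eqE /=; case: ltngtP => _; rewrite ?mul1r ?mulr1 ?mul0r.
rewrite big_split /= -big_mkcond /= prodr_const /word_asc cardsE; congr (_ * _).
rewrite /word_proper; case: forallP => [h|/forallP].
  by rewrite big1 // => i _; rewrite (h i).
by case/forallPn => i /negbTE h; rewrite (bigD1 i) //= h mul0r.
Qed.

(** Substituting the variable of index [s j] for [x_j] lets the permuted content be read off at the
    same monomial [m] as the original one, so an identity of generating functions compares the two
    counts. *)
Lemma coef_word_gf (n N k : nat) (act : pred nat) (s : 'S_N) (m : 'X_{1..N}) :
  ((\sum_c word_gf ('X%:MP : {mpoly {poly int}[N]}) (fun j => 'X_(s j)) n act c)@_m)`_k =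
  (word_coef n act k [ffun j => m (s j)])%:R.
Proof.
rewrite sum_word_gf raddf_sum coef_sum /=.
rewrite /word_coef -sum1_card natr_sum [RHS]big_mkcond /=.
apply: eq_bigr => w _; rewrite inE prod_step_weight.
pose mw := (\big[mnm_add/mnm0]_(i < n.+1) U_(s (w i)))%MM.
have -> : \prod_i 'X_(s (w i)) = 'X_[mw] :> {mpoly {poly int}[N]}.
  rewrite /mw -(big_map (fun i => U_(s (w i))%MM) predT id) -mpolyX_prod big_map.
  by [].
have mE : (mw == m) = has_content w [ffun j => m (s j)].
  apply/eqP/forallP => [<- j|h]; last apply/mnmP => j.
    rewrite ffunE mnm_sumE -sum1dep_card big_mkcond /=; apply/eqP/eq_bigr => i _.
    by rewrite mnm1E (inj_eq perm_inj); case: eqP.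
  have /eqP := h ((s^-1)%g j); rewrite ffunE permKV => <-.
  rewrite mnm_sumE -sum1dep_card [in RHS]big_mkcond /=; apply/eq_bigr => i _.
  by rewrite mnm1E (canF_eq (permK s)); case: eqP.
rewrite -mE mulrC -mulrA -rmorphXn /= mulrC -mulrA mulr_natr.
rewrite mcoeffCM mcoeffMn mcoeffX.
case: word_proper; case: (mw == m); rewrite /= ?andbF ?mulr0n ?mulr0 ?coef0 //.
by rewrite mulr1 coefXn eq_sym andbT; case: eqP.
Qed.

Local Close Scope ring_scope.

Lemma word_coef_swap (n k N : nat) (act : pred nat) (a : {ffun 'I_N -> nat}) (lo hi : 'I_N) :
  hi = lo.+1 :> nat ->
  word_coef n act k a = word_coef n act k [ffun j => a (tperm lo hi j)].
Proof.
move=> hE; pose m := [multinom a j | j < N].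
have aE s : [ffun j => a ((s : 'S_N) j)] = [ffun j => m (s j)].
  by apply/ffunP => j; rewrite !ffunE mnmE.
have a1 : a = [ffun j => m ((1 : 'S_N)%g j)] by apply/ffunP => j; rewrite ffunE mnmE perm1.
apply/eqP; rewrite -(eqr_nat int) aE {1}a1 -!coef_word_gf.
rewrite -(sum_word_gf_swap _ _ _ _ hE).
apply/eqP; apply: (congr1 (fun p : {mpoly {poly int}[N]} => (p@_m)`_k)%R).
apply: eq_bigr => c _; apply: eq_word_gf => j /=.
by rewrite perm1.
Qed.

(** The permutations that preserve all coefficients are closed under products, and adjacent
    transpositions generate the symmetric group. *)
Lemma word_coef_perm (n k N : nat) (act : pred nat) (a : {ffun 'I_N -> nat}) (s : 'S_N) :
  word_coef n act k a = word_coef n act k [ffun j => a (s j)].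
Proof.
pose Q (s : 'S_N) := forall a, word_coef n act k a = word_coef n act k [ffun j => a (s j)].
have QM s1 s2 : Q s1 -> Q s2 -> Q (s1 * s2)%g.
  move=> Q1 Q2 b; rewrite Q2 Q1; congr word_coef; apply/ffunP => j.
  by rewrite !ffunE permM.
have Qt d (i j : 'I_N) : j = i + d :> nat -> Q (tperm i j).
  elim: d i j => [|[|d] IH] i j jE b.
  - have -> : j = i by apply: val_inj; rewrite /= jE addn0.
    by congr word_coef; apply/ffunP => l; rewrite ffunE tperm1 perm1.
  - by apply: (@word_coef_swap _ _ _ _ _ i j); rewrite jE addn1.
  have hl : i + d.+1 < N by have := ltn_ord j; rewrite jE; lia.
  have lj : Q (tperm (Ordinal hl) j).
    by move=> ?; apply: (@word_coef_swap _ _ _ _ _ (Ordinal hl) j); rewrite jE /= addnS.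
  have il : Q (tperm i (Ordinal hl)) by apply: IH.
  (* [Ordinal hl] is the color just below [j]: conjugation reduces the distance between the
     exchanged colors by one. *)
  have -> : tperm i j = (tperm (Ordinal hl) j ^ tperm i (Ordinal hl))%g.
    by rewrite tpermJ tpermR tpermD // -val_eqE /= jE; lia.
  by rewrite /conjg tpermV; exact: (QM _ _ il (QM _ _ lj il)).
have [ts -> _] := prod_tpermP s.
apply: (big_ind Q) a => // [|[i j] _] b /=.
  by congr word_coef; apply/ffunP => l; rewrite ffunE perm1.
case: (leqP i j) => ij; first by apply: (Qt (j - i)); rewrite subnKC.
by rewrite tpermC; apply: (Qt (i - j)); rewrite subnKC // ltnW.
Qed.

(** * Words following an up/down pattern and the sizes of their color classes *)

Definition step (u : pred nat) (f : nat -> nat) (x : nat) : bool :=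
  if u x then f x < f x.+1 else f x.+1 < f x.

Definition letter (n N : nat) (w : {ffun 'I_n.+1 -> 'I_N}) (x : nat) : nat := w (inord x).

Definition fits (n N : nat) (u : pred nat) (w : {ffun 'I_n.+1 -> 'I_N}) : bool :=
  [forall i : 'I_n, step u (letter w) i].

Definition fits_coef (n : nat) (u : pred nat) (N : nat) (a : {ffun 'I_N -> nat}) : nat :=
  #|[set w : {ffun 'I_n.+1 -> 'I_N} | fits u w && has_content w a]|.

Definition fits_symmetric (n : nat) (u : pred nat) : Prop :=
  forall (N : nat) (a : {ffun 'I_N -> nat}) (s : 'S_N),
    fits_coef n u a = fits_coef n u [ffun m => a (s m)].

(** The minimal elements of the fence poset, in which step [x] joins [x] to [x.+1]. The tests
    [x == 0] and [x == n] skip the missing neighbor at an end. *)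
Definition valley (n : nat) (u : pred nat) (x : nat) : bool :=
  ((x == 0) || ~~ u x.-1) && ((x == n) || u x).

Definition peak (n : nat) (u : pred nat) (x : nat) : bool :=
  ((x == 0) || u x.-1) && ((x == n) || ~~ u x).

Lemma fitsP (n N : nat) (u : pred nat) (w : {ffun 'I_n.+1 -> 'I_N}) :
  reflect (forall x, x < n -> step u (letter w) x) (fits u w).
Proof.
apply: (iffP forallP) => [h x xn|h i]; last exact: h.
by have := h (Ordinal xn).
Qed.

Lemma letter_val (n N : nat) (w : {ffun 'I_n.+1 -> 'I_N}) (x : 'I_n.+1) : letter w x = w x.
Proof. by rewrite /letter inord_val. Qed.

Definition word_of (n B : nat) (f : nat -> nat) : {ffun 'I_n.+1 -> 'I_B.+1} :=
  [ffun x : 'I_n.+1 => inord (f x)].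

Lemma letter_word_of (n B : nat) (f : nat -> nat) (x : nat) :
  (forall y, y <= n -> f y <= B) -> x <= n -> letter (word_of n B f) x = f x.
Proof. by move=> fB xn; rewrite /letter ffunE !inordK ?ltnS ?fB. Qed.

Definition content (n N : nat) (w : {ffun 'I_n.+1 -> 'I_N}) : {ffun 'I_N -> nat} :=
  [ffun m => #|[set x | w x == m]|].

Lemma has_contentE (n N : nat) (w : {ffun 'I_n.+1 -> 'I_N}) (a : {ffun 'I_N -> nat}) :
  has_content w a = (a == content w).
Proof.
apply/forallP/eqP => [h|-> m]; last by rewrite ffunE.
by apply/ffunP => m; rewrite ffunE (eqP (h m)).
Qed.

(** Only positivity is used: [w] makes the coefficient of its own content nonzero, hence symmetry
    makes the permuted one nonzero. *)
Lemma fits_permuted (n N : nat) (u : pred nat) (w : {ffun 'I_n.+1 -> 'I_N}) (s : 'S_N) :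
  fits_symmetric n u -> fits u w ->
  exists2 w' : {ffun 'I_n.+1 -> 'I_N}, fits u w' & forall m, content w' m = content w (s m).
Proof.
move=> H fw; have : 0 < fits_coef n u (content w).
  by apply/card_gt0P; exists w; rewrite inE fw has_contentE eqxx.
rewrite (H _ _ s) => /card_gt0P[w']; rewrite inE has_contentE => /andP[fw' /eqP e].
by exists w' => // m; rewrite -e ffunE.
Qed.

(** Symmetry moves color [m] to the smallest color, which can only occur where no neighbor is below,
    and likewise to the largest color, which can only occur at peaks. *)
Lemma card_class_le (n : nat) (u : pred nat) (f : nat -> nat) (m : nat) :
  fits_symmetric n u -> (forall x, x < n -> step u f x) ->
  #|[set x : 'I_n.+1 | f x == m]| <= #|[set x : 'I_n.+1 | valley n u x]| /\
  #|[set x : 'I_n.+1 | f x == m]| <= #|[set x : 'I_n.+1 | peak n u x]|.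
Proof.
(* Adding [m] ensures that [m] is among the colors even if [f] does not take this value. *)
move=> H fs; pose B := (\max_(x < n.+1) f x) + m.
have fB x : x <= n -> f x <= B.
  move=> xn; rewrite (leq_trans _ (leq_addr _ _)) //.
  by have := @leq_bigmax _ (fun i : 'I_n.+1 => f i) (inord x); rewrite inordK.
pose w := word_of n B f.
have fw : fits u w.
  apply/fitsP => x xn; have := fs x xn.
  by rewrite /step !letter_word_of // ltnW.
have -> : #|[set x : 'I_n.+1 | f x == m]| = content w (inord m).
  rewrite ffunE; congr #|pred_of_set _|; apply/setP => x; rewrite !inE.
  rewrite -val_eqE /= -letter_val letter_word_of ?inordK ?ltnS ?leq_addl //.
  by rewrite -ltnS.
split.
  have [w' /fitsP fw' e] := fits_permuted (tperm ord0 (inord m)) H fw.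
  rewrite -(tpermL ord0 (inord m)) -e ffunE; apply/subset_leq_card/subsetP => x.
  rewrite !inE -val_eqE /= -letter_val /valley; move: (ltn_ord x); case: (val x) => [|y] /=.
    rewrite ltnS leq_eqVlt => /orP[->|yn /eqP w0]; first by [].
    by have := fw' _ yn; rewrite /step w0 ltn0; case: (u 0); rewrite ?orbT.
  rewrite !ltnS => yn /eqP w0; apply/andP; split.
    by have := fw' _ yn; rewrite /step w0 ltn0; case: (u y).
  case: (ltngtP y.+1 n) yn => // y1n _.
  by have := fw' _ y1n; rewrite /step w0 ltn0; case: (u y.+1).
have [w' /fitsP fw' e] := fits_permuted (tperm ord_max (inord m)) H fw.
have wB x : ~~ (B < letter w' x) by rewrite -leqNgt -ltnS ltn_ord.
rewrite -(tpermL ord_max (inord m)) -e ffunE; apply/subset_leq_card/subsetP => x.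
rewrite !inE -val_eqE /= -letter_val /peak; move: (ltn_ord x); case: (val x) => [|y] /=.
  rewrite ltnS leq_eqVlt => /orP[->|yn /eqP w0]; first by [].
  by have := fw' _ yn; rewrite /step w0 (negbTE (wB _)); case: (u 0); rewrite ?orbT.
rewrite !ltnS => yn /eqP w0; apply/andP; split.
  by have := fw' _ yn; rewrite /step w0 (negbTE (wB _)); case: (u y).
case: (ltngtP y.+1 n) yn => // y1n _.
by have := fw' _ y1n; rewrite /step w0 (negbTE (wB _)); case: (u y.+1).
Qed.

Lemma card_ord_pred (n : nat) (P : pred nat) :
  #|[set x : 'I_n | P x]| = \sum_(0 <= x < n) P x.
Proof.
by rewrite big_mkord -sum1dep_card big_mkcond; apply: eq_bigr => i _; case: (P i).
Qed.

(** Valleys and peaks alternate, so the difference of their numbers in a prefix is determined by the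
    first step and by the step [y] that leaves the prefix. *)
Lemma valley_peak_prefix (n : nat) (u : pred nat) (y : nat) : y < n ->
  \sum_(0 <= x < y.+1) valley n u x + 1 = \sum_(0 <= x < y.+1) peak n u x + u 0 + u y.
Proof.
elim: y => [|y IH] yn.
  rewrite !big_nat1 /valley /peak eqxx /= (ltn_eqF yn) /=; by case: (u 0).
rewrite big_nat_recr //= [in RHS]big_nat_recr //=.
have := IH (ltnW yn); rewrite /valley /peak /= (ltn_eqF yn) /=.
by case: (u y); case: (u y.+1) => /=; lia.
Qed.

(** All valleys can be given one color below the rest, and all peaks one color above. The class
    bounds then make valleys and peaks equally many, so by alternation one end is a valley and the
    other a peak. *)
Lemma symmetric_ends (n : nat) (u : pred nat) (L : nat -> nat) :
  fits_symmetric n.+1 u -> (forall x, x < n.+1 -> step u L x) ->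
  (forall x, L x <= n.+1) -> u 0 = u n.
Proof.
move=> H Ls Ln.
pose f x := if valley n.+1 u x then 0 else (L x).+1.
pose g x := if peak n.+1 u x then n.+2 else L x.
have fs x : x < n.+1 -> step u f x.
  move=> xn; have := Ls x xn; rewrite /step /f /valley /= (ltn_eqF xn) /= eqSS.
  by case: (u x); rewrite ?andbF //=; case: ifP.
have gs x : x < n.+1 -> step u g x.
  move=> xn; have := Ls x xn; rewrite /step /g /peak /= (ltn_eqF xn) /= eqSS.
  by case: (u x); rewrite ?andbF //=; case: ifP => // _; rewrite ltnS Ln.
have [_ h1] := card_class_le 0 H fs; have [h2 _] := card_class_le n.+2 H gs.
have e1 : [set x : 'I_n.+2 | f x == 0] = [set x : 'I_n.+2 | valley n.+1 u x].
  by apply/setP => x; rewrite !inE /f; case: ifP.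
have e2 : [set x : 'I_n.+2 | g x == n.+2] = [set x : 'I_n.+2 | peak n.+1 u x].
  by apply/setP => x; rewrite !inE /g; case: ifP; rewrite ?eqxx // ltn_eqF // ltnS Ln.
have := valley_peak_prefix u (ltnSn n).
have r (P : pred nat) : \sum_(0 <= x < n.+2) P x = \sum_(0 <= x < n.+1) P x + P n.+1.
  exact: big_nat_recr.
move: h1 h2; rewrite e1 e2 !card_ord_pred !r.
have -> : valley n.+1 u n.+1 = ~~ u n by rewrite /valley eqxx andbT.
have -> : peak n.+1 u n.+1 = u n by rewrite /peak eqxx andbT.
by case: (u 0); case: (u n) => /=; lia.
Qed.

Lemma symmetric_no_double_descent (n : nat) (u : pred nat) (L : nat -> nat) (y : nat) :
  fits_symmetric n u -> (forall x, x < n -> step u L x) -> (forall x, L x <= n) ->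
  u 0 -> y.+1 < n -> u y || u y.+1.
Proof.
move=> H Ls Ln u0 yn; apply/negPn/negP; rewrite negb_or => /andP[/negbTE uy /negbTE uy1].
(* The class: the valleys left of [y.+1], the point [y.+1] itself, and the peaks to its right. *)
pose f x := if x < y.+1 then (if valley n u x then n.+1 else n.+2 + L x)
            else if x == y.+1 then n.+1 else if peak n u x then n.+1 else L x.
(* The value [n.+1] separates: the other letters left of [y.+1] are lifted above it by the shift
   [n.+2], those to the right stay at most [n]. *)
have fs x : x < n -> step u f x.
  move=> xn; have := Ls x xn; have := Ln x; have := Ln x.+1.
  rewrite /step /f /valley /peak /= (ltn_eqF xn) /=.
  rewrite !ltnS !eqSS.
  case: (ltngtP x y) => [xy|xy|xy].
  - by case: (u x); rewrite ?andbF ?orbF ?andbT /=; do ?case: ifP => //; lia.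
  - case: (eqVneq x y.+1) => [->|ne]; first by rewrite uy1 /=; do ?case: ifP; lia.
    by case: (u x); rewrite ?andbF ?orbF ?andbT /=; do ?case: ifP => //; lia.
  by rewrite xy uy /= ?andbF /=; do ?case: ifP => //; lia.
(* As [u] starts upwards and step [y] descends, the positions up to [y] contain as many valleys as
   peaks. The class therefore exceeds the peaks by one, namely by [y.+1], which is not a peak. *)
have [_ ] := card_class_le n.+1 H fs.
have := valley_peak_prefix u (ltnW yn); rewrite u0 uy /=.
rewrite (card_ord_pred _ (fun x => f x == n.+1)) (card_ord_pred _ (peak n u)).
have r (P : pred nat) : \sum_(0 <= x < n.+1) P x =
    \sum_(0 <= x < y.+1) P x + (P y.+1 + \sum_(y.+2 <= x < n.+1) P x).
  rewrite (@big_cat_nat _ _ _ y.+1) //=; last by rewrite ltnW // ltnW.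
  by congr (_ + _); rewrite big_ltn // ltnW.
rewrite (r (fun x => f x == n.+1)) (r (peak n u)).
have -> : \sum_(0 <= x < y.+1) (f x == n.+1) = \sum_(0 <= x < y.+1) valley n u x.
  apply: eq_big_nat => x /andP[_ xy]; rewrite /f xy; case: ifP => _; first by rewrite eqxx.
  by rewrite gtn_eqF //; lia.
have -> : \sum_(y.+2 <= x < n.+1) (f x == n.+1) = \sum_(y.+2 <= x < n.+1) peak n u x.
  apply: eq_big_nat => x /andP[yx _]; rewrite /f ltnNge (ltnW yx) /= (gtn_eqF yx).
  by case: ifP => _; rewrite ?eqxx // ltn_eqF // ltnS Ln.
have -> : f y.+1 = n.+1 by rewrite /f ltnn eqxx.
have -> : peak n u y.+1 = false by rewrite /peak /= uy.
by rewrite eqxx; lia.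
Qed.

(** * Dropping the descents: disjoint unions of chains *)

Definition ascends (n N : nat) (u : pred nat) (w : {ffun 'I_n.+1 -> 'I_N}) : bool :=
  [forall i : 'I_n, u i ==> (letter w i < letter w i.+1)].

Definition ascends_coef (n : nat) (u : pred nat) (N : nat) (a : {ffun 'I_N -> nat}) : nat :=
  #|[set w : {ffun 'I_n.+1 -> 'I_N} | ascends u w && has_content w a]|.

Lemma ascendsP (n N : nat) (u : pred nat) (w : {ffun 'I_n.+1 -> 'I_N}) :
  reflect (forall x, x < n -> u x -> letter w x < letter w x.+1) (ascends u w).
Proof.
apply: (iffP forallP) => [h x xn|h i]; first exact/implyP/(h (Ordinal xn)).
by apply/implyP => ui; apply: h.
Qed.

Lemma fits_ascends (n N : nat) (u : pred nat) (w : {ffun 'I_n.+1 -> 'I_N}) :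
  fits u w -> ascends u w.
Proof. by move/fitsP => fw; apply/ascendsP => x xn ux; have := fw x xn; rewrite /step ux. Qed.

(** If the active steps are the ascents of [u], the ascending words are those with the largest
    possible number of active ascents, and they are automatically proper. This gives access to the
    symmetry of [word_coef]. *)
Lemma ascends_coefE (n N : nat) (u : pred nat) (a : {ffun 'I_N -> nat}) :
  ascends_coef n u a = word_coef n u #|[set i : 'I_n | u i]| a.
Proof.
congr #|pred_of_set _|; apply/setP => w; rewrite !inE andbA; congr (_ && _).
apply/forallP/andP => [h|[_ /eqP h] i].
  split.
    apply/forallP => i; apply/implyP => ui; have := h i.
    by rewrite ui -val_eqE /= ltn_neqAle => /andP[].
  apply/eqP; congr #|pred_of_set _|; apply/setP => i; rewrite !inE.
  by have := h i; rewrite /letter; case: (u i) => //= ->.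
have /eqP/setP/(_ i) :
    [set i : 'I_n | u i && (w (inord i) < w (inord i.+1))] == [set i : 'I_n | u i].
  rewrite eqEcard -h leqnn andbT; apply/subsetP => j; rewrite !inE => /andP[] //.
by rewrite !inE /letter; case: (u i) => //= ->.
Qed.

Lemma ascends_coef_perm (n N : nat) (u : pred nat) (a : {ffun 'I_N -> nat}) (s : 'S_N) :
  ascends_coef n u a = ascends_coef n u [ffun m => a (s m)].
Proof. by rewrite !ascends_coefE; apply: word_coef_perm. Qed.

(** The first hypothesis says that the valleys are the minima of the chains. In an ascending word
    color 0 occurs only there, so by its multiplicity it fills them all. Each descent then runs from
    a positive color down to 0. *)
Lemma fits_coef_valleys (n N : nat) (u : pred nat) (a : {ffun 'I_N.+1 -> nat}) :
  (forall x, x <= n -> valley n u x = (x == 0) || ~~ u x.-1) ->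
  a ord0 = #|[set x : 'I_n.+1 | valley n u x]| ->
  fits_coef n u a = ascends_coef n u a.
Proof.
move=> vE a0; congr #|pred_of_set _|; apply/setP => w; rewrite !inE.
apply/andP/andP => -[fw wa]; split=> //; first exact: fits_ascends.
move: wa; rewrite has_contentE => /eqP wa.
have /eqP/setP cE : [set x | w x == ord0] == [set x : 'I_n.+1 | valley n u x].
  rewrite eqEcard -a0 wa ffunE leqnn andbT; apply/subsetP => x; rewrite !inE.
  rewrite -val_eqE /= -letter_val vE -1?ltnS //; move: (ltn_ord x).
  case: (val x) => //= y yn /eqP w0.
  by apply/negP => uy; have := ascendsP _ _ fw y yn uy; rewrite w0.
have lE x : x <= n -> (letter w x == 0) = valley n u x.
  by move=> xn; have := cE (inord x); rewrite !inE inordK // -val_eqE.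
apply/fitsP => x xn; rewrite /step; case: ifP => ux; first exact: (ascendsP _ _ fw).
have /eqP -> : letter w x.+1 == 0 by rewrite lE // vE //= ux.
by rewrite lt0n lE 1?ltnW // /valley (ltn_eqF xn) ux andbF.
Qed.

(** The third hypothesis excludes consecutive descents and a final descent, so every descent ends at
    a valley and the valleys are the minima of the chains. *)
Lemma symmetric_all_ascents (n : nat) (u : pred nat) :
  fits_symmetric n u -> u 0 ->
  (forall x, 0 < x <= n -> u x.-1 || ((x < n) && u x)) ->
  forall x, x < n -> u x.
Proof.
move=> H u0 nd x0 x0n; apply/negPn/negP => ux0.
have ex : exists x, (x < n) && ~~ u x by exists x0; rewrite x0n.
(* The first descent [y] is chosen so that 0 is the only valley up to [y]. *)
case: (ex_minnP ex) => y /andP[yn uy] ymin.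
have y0 : 0 < y by case: y uy {yn ymin} => //; rewrite u0.
have vE x : x <= n -> valley n u x = (x == 0) || ~~ u x.-1.
  move=> xn; rewrite /valley; case: (posnP x) => [->|xp]; first by rewrite u0 orbT.
  have := nd x; rewrite xp xn /= => /(_ isT).
  by case: (u x.-1) => //= /andP[_ ->]; rewrite orbT.
(* Color [y] is used once on each chain, in particular at both ends of the descent [y]. *)
pose f x := if valley n u x && (y < x) then y else x.
pose w := word_of n n f.
have fn x : x <= n -> f x <= n by move=> xn; rewrite /f; case: ifP => // _; apply: ltnW.
have aw : ascends u w.
  apply/ascendsP => x xn ux; rewrite !letter_word_of ?(ltnW xn) // /f.
  by rewrite (vE x.+1) //= ux /=; case: ifP => // /andP[_ /ltnW].
(* The class of color [y] arises from the set of valleys by exchanging the valley 0 for the position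
   [y]. *)
have cw : content w (inord y) = #|[set x : 'I_n.+1 | valley n u x]|.
  have vy x : x <= y -> valley n u x = (x == 0).
    move=> xy; rewrite vE ?(leq_trans xy) 1?ltnW //; case: x xy => //= x xy.
    apply/negbTE; rewrite negbK; apply/negPn/negP => ux.
    by have := ymin x; rewrite ux (ltn_trans xy yn) => /(_ isT); lia.
  pose S := [set x : 'I_n.+1 | valley n u x] :\ ord0.
  have -> : [set x : 'I_n.+1 | valley n u x] = ord0 |: S.
    by rewrite setD1K // inE vy.
  rewrite ffunE cardsU1 !inE eqxx /=.
  have -> : [set x | w x == inord y] = inord y |: S.
    apply/setP => x; rewrite !inE -!val_eqE /= -letter_val letter_word_of // -1?ltnS //.
    rewrite inordK ?ltnS 1?ltnW // /f.
    case: (ltngtP y x) => [yx|xy|<-]; rewrite ?andbF ?eqxx //=.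
      by rewrite andbT (gtn_eqF (ltn_trans y0 yx)) /=; case: ifP; rewrite ?eqxx // gtn_eqF.
    rewrite vy 1?ltnW // ltn_eqF //=; by case: eqP.
  rewrite cardsU1 !inE -val_eqE /= inordK ?ltnS 1?ltnW // vy //.
  by rewrite (gtn_eqF y0).
pose t := tperm ord0 (inord y : 'I_n.+1).
(* Both counts are symmetric, so the class of color [y] may be moved to color 0, where they
   agree. *)
have e : fits_coef n u (content w) = ascends_coef n u (content w).
  rewrite (H _ _ t) (ascends_coef_perm _ _ _ t); apply: fits_coef_valleys => //.
  by rewrite ffunE tpermL.
(* Inclusion and equal cardinality make the two sets of words equal, so [w] would have to descend
   strictly at [y], where it is constant. *)
have /eqP/setP/(_ w) : [set v : {ffun 'I_n.+1 -> 'I_n.+1} | fits u v && has_content v (content w)]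
    == [set v | ascends u v && has_content v (content w)].
  rewrite eqEcard -/(ascends_coef _ _ _) -/(fits_coef _ _ _) e leqnn andbT.
  by apply/subsetP => v; rewrite !inE => /andP[/fits_ascends -> ->].
rewrite !inE aw has_contentE eqxx !andbT => /fitsP/(_ y yn).
rewrite /step (negbTE uy) !letter_word_of ?(ltnW yn) // /f vE //= uy ltnSn ltnn andbF.
by rewrite ltnn.
Qed.

(** * Labeled paths and their patterns *)

Definition path_up (n : nat) (sigma : 'S_n.+1) : pred nat :=
  fun x => sigma (inord x) < sigma (inord x.+1).

Lemma path_relP (n : nat) (sigma : 'S_n.+1) (i j : 'I_n.+1) :
  reflect (exists2 x, x < n &
      i = sigma (inord x) /\ j = sigma (inord x.+1) \/
      j = sigma (inord x) /\ i = sigma (inord x.+1))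
    (path_rel sigma i j).
Proof.
apply: (iffP existsP) => [[p /existsP[p' /andP[/eqP pp' h]]]|[x xn h]].
  have pn : p < n by rewrite -ltnS -pp' ltn_ord.
  exists p => //; rewrite -pp' !inord_val.
  by case/orP: h => /andP[/eqP <- /eqP <-]; [left|right].
exists (inord x); apply/existsP; exists (inord x.+1).
rewrite /= !inordK ?ltnS ?(ltnW xn) // eqxx /=.
by case: h => -[-> ->]; rewrite !eqxx ?orbT.
Qed.

Lemma step_neq (n : nat) (sigma : 'S_n.+1) (x : nat) : x < n ->
  sigma (inord x) != sigma (inord x.+1).
Proof.
by move=> xn; rewrite (inj_eq perm_inj) -val_eqE /= !inordK ?ltnS ?(ltnW xn) // ltn_eqF.
Qed.

Lemma path_up_step (n : nat) (sigma : 'S_n.+1) (x : nat) : x < n ->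
  step (path_up sigma) (fun y => sigma (inord y)) x.
Proof.
move=> xn; rewrite /step /path_up; case: ltngtP => // e.
by have := step_neq sigma xn; rewrite -val_eqE /= e eqxx.
Qed.

Lemma eq_cqf_symmetric (n : nat) (e1 e2 : rel 'I_n) :
  e1 =2 e2 -> cqf_symmetric e1 -> cqf_symmetric e2.
Proof.
move=> e12; suff coefE k N (a : {ffun 'I_N -> nat}) : cqf_coef e1 k a = cqf_coef e2 k a.
  by move=> h k N a s; rewrite -!coefE.
congr #|pred_of_set _|; apply/setP => c; rewrite !inE.
have -> : Defs.proper e1 c = Defs.proper e2 c.
  by apply: eq_forallb => i; apply: eq_forallb => j; rewrite e12.
suff -> : asc e1 c = asc e2 c by [].
by congr #|pred_of_set _|; apply/setP => ij; rewrite !inE e12.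
Qed.

Definition rev_perm (n : nat) : 'S_n := perm (@rev_ord_inj n).

(** Reading the path from its other end yields the same graph, while the pattern is reversed and
    complemented. *)
Lemma path_rel_rev (n : nat) (sigma : 'S_n.+1) :
  path_rel (rev_perm n.+1 * sigma)%g =2 path_rel sigma.
Proof.
have revE x : x <= n -> (rev_perm n.+1 * sigma)%g (inord x) = sigma (inord (n - x)).
  move=> xn; rewrite permM permE; congr (sigma _); apply: val_inj.
  by rewrite /= !inordK ?ltnS ?leq_subr.
move=> i j; apply/path_relP/path_relP => -[x xn h].
  exists (n - x.+1); first by lia.
  have -> : (n - x.+1).+1 = n - x by lia.
  by move: h; rewrite !revE ?(ltnW xn) // => -[] []; [right|left].
exists (n - x.+1); first by lia.
have -> : (n - x.+1).+1 = n - x by lia.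
rewrite !revE ?leq_subr // !subKn ?(ltnW xn) //.
by case: h => -[]; [right|left].
Qed.

Lemma path_rel1_coef (n k N : nat) (a : {ffun 'I_N -> nat}) :
  cqf_coef (path_rel (1 : 'S_n.+1)%g) k a = word_coef n predT k a.
Proof.
congr #|pred_of_set _|; apply/setP => c; rewrite !inE.
have -> : Defs.proper (path_rel 1%g) c = word_proper predT c.
  apply/forallP/forallP => [h i|h i].
    apply: (implyP (forallP (h _) _)); apply/path_relP; exists i => //.
    by left; rewrite !perm1.
  apply/forallP => j; apply/implyP => /path_relP[x xn]; rewrite !perm1.
  by have := h (Ordinal xn) => /= hx [[-> ->]|[-> ->]] //; rewrite eq_sym.
suff -> : asc (path_rel 1%g) c = word_asc predT c by [].
(* Under the identity labeling, [g] lists each edge once with its smaller label first. *)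
pose g (i : 'I_n) : 'I_n.+1 * 'I_n.+1 := (inord i, inord i.+1).
have g_inj : injective g.
  move=> i j [/(congr1 val)]; rewrite /= !inordK ?ltnS ?(ltnW (ltn_ord _)) //.
  by move=> e _; apply: val_inj.
rewrite /word_asc -(card_imset _ g_inj); congr #|pred_of_set _|; apply/setP => -[i j].
rewrite inE /=; apply/and3P/imsetP => [[/path_relP[x xn]]|[x]].
  rewrite !perm1 => -[[-> ->]|[-> ->]]; last by rewrite !inordK ?ltnS ?(ltnW xn) // ltnNge leqnSn.
  by move=> _ h; exists (Ordinal xn); rewrite ?inE.
rewrite inE /= => h [-> ->]; split=> //; last first.
  by rewrite !inordK ?ltnS // ltnW.
by apply/path_relP; exists x => //; left; rewrite !perm1.
Qed.

Lemma path_rel1_symmetric (n : nat) : cqf_symmetric (path_rel (1 : 'S_n.+1)%g).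
Proof. by move=> k N a s; rewrite !path_rel1_coef; apply: word_coef_perm. Qed.

(** The exponent is the number of edges, so every edge must be an ascent; properness is then
    automatic. Reading the coloring along the path by [phi] keeps the content. *)
Lemma top_coef_fits (n N : nat) (sigma : 'S_n.+1) (a : {ffun 'I_N -> nat}) :
  cqf_coef (path_rel sigma)
    #|[set ij : 'I_n.+1 * 'I_n.+1 | path_rel sigma ij.1 ij.2 && (ij.1 < ij.2)]| a
  = fits_coef n (path_up sigma) a.
Proof.
pose phi (c : {ffun 'I_n.+1 -> 'I_N}) : {ffun 'I_n.+1 -> 'I_N} := [ffun p => c (sigma p)].
have phi_inj : injective phi.
  move=> c d /ffunP h; apply/ffunP => i; have := h ((sigma^-1)%g i).
  by rewrite !ffunE permKV.
rewrite /fits_coef -(card_preimset _ phi_inj); congr #|pred_of_set _|; apply/setP => c.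
rewrite !inE andbA; congr (_ && _); last first.
  apply: eq_forallb => m; congr (_ == _).
  rewrite -(card_preimset _ (@perm_inj _ sigma)); congr #|pred_of_set _|.
  by apply/setP => x; rewrite !inE ffunE.
set E := [set ij : 'I_n.+1 * 'I_n.+1 | _].
have ascE : (asc (path_rel sigma) c == #|E|) =
    [forall ij in E, c ij.1 < c ij.2].
  rewrite /asc; set A := [set ij : 'I_n.+1 * 'I_n.+1 | _].
  have AE : A \subset E by apply/subsetP => ij; rewrite !inE => /and3P[-> ->].
  rewrite (subset_leqif_cards AE) eqEsubset AE /=.
  apply/subsetP/forall_inP => h ij ijE; first by have := h _ ijE; rewrite inE => /and3P[].
  by move: (ijE) (h _ ijE); rewrite !inE => /andP[-> ->] ->.
apply/andP/fitsP => [[_]|h].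
  rewrite ascE => /forall_inP h x xn; rewrite /step /letter !ffunE.
  case: ifP => ux; [apply: (h (_, _))|apply: (h (_, _))]; rewrite inE /=; apply/andP; split => //.
  - by apply/path_relP; exists x => //; left.
  - by apply/path_relP; exists x => //; right.
  by have := path_up_step sigma xn; rewrite /step ux.
split.
  apply/forallP => i; apply/forallP => j; apply/implyP => /path_relP[x xn].
  have : c (sigma (inord x)) != c (sigma (inord x.+1)).
    have := h x xn; rewrite /step /letter !ffunE -val_eqE /= neq_ltn.
    by case: ifP => _ ->; rewrite ?orbT.
  by move=> ne [[-> ->]|[-> ->]] //; rewrite eq_sym.
rewrite ascE; apply/forall_inP => -[i j]; rewrite inE /= => /andP[/path_relP[x xn]].
have := h x xn; have := path_up_step sigma xn; rewrite /step /letter !ffunE.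
case: ifP => _ s1 s2 [[-> ->]|[-> ->]] // s3; have := ltn_trans s1 s3; by rewrite ltnn.
Qed.

Lemma path_up_perm1 (n : nat) (sigma : 'S_n.+1) :
  (forall x, x < n -> path_up sigma x) -> sigma = 1%g.
Proof.
move=> up; pose f x : nat := sigma (inord x).
(* A strict increase gains at least one per step; comparison with positions 0 and [n] leaves no
   slack within the range from 0 to [n]. *)
have mono x y : x <= y -> y <= n -> f x + (y - x) <= f y.
  elim: y => [|y IH]; first by rewrite leqn0 => /eqP ->; rewrite subnn addn0.
  rewrite leq_eqVlt => /orP[/eqP -> _|]; first by rewrite subnn addn0.
  rewrite ltnS => xy yn; have := IH xy (ltnW yn); have := up y yn; rewrite /path_up -/(f _) -/(f _).
  by rewrite subSn // addnS => h1 h2; apply: leq_ltn_trans h1.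
apply/permP => x; rewrite perm1; apply: val_inj => /=.
have xn : x <= n by rewrite -ltnS.
have := mono 0 x (leq0n _) xn; have := mono x n xn (leqnn n).
have : f n <= n by rewrite -ltnS ltn_ord.
by rewrite /f inord_val; lia.
Qed.

Lemma symmetric_path_ends (n : nat) (sigma : 'S_n.+2) :
  cqf_symmetric (path_rel sigma) -> path_up sigma 0 = path_up sigma n.
Proof.
move=> H; apply: (@symmetric_ends _ _ (fun y => sigma (inord y))) => [N a s|x|x].
- by rewrite -!top_coef_fits; apply: H.
- exact: path_up_step.
- by rewrite -ltnS ltn_ord.
Qed.

Lemma symmetric_path_up (n : nat) (sigma : 'S_n.+2) :
  cqf_symmetric (path_rel sigma) -> path_up sigma 0 -> sigma = 1%g.
Proof.
move=> H u0; apply: path_up_perm1.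
have Hf : fits_symmetric n.+1 (path_up sigma).
  by move=> N a s; rewrite -!top_coef_fits; apply: H.
have un := symmetric_path_ends H; rewrite u0 in un.
apply: symmetric_all_ascents => // -[//|x] /=; rewrite ltnS => xn.
(* At the last position the final step must itself ascend, which holds because it agrees with the
   first one. *)
case: (ltngtP x n) xn => // [xn _|-> _]; last by rewrite -un.
rewrite ltnS xn; apply: (@symmetric_no_double_descent _ _ (fun y => sigma (inord y))) => // y.
  exact: path_up_step.
by rewrite -ltnS ltn_ord.
Qed.

Theorem theorem1p1 (n : nat) (hn : (1 <= n)%N) (sigma : 'S_n) :
  cqf_symmetric (path_rel sigma) <-> natural_labeling sigma.
Proof.
case: n hn sigma => // -[|n] _ sigma.
  have -> : sigma = 1%g by apply/permP => i; rewrite !ord1.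
  by split=> _; [left|apply: path_rel1_symmetric].
have rev_symm : cqf_symmetric (path_rel (rev_perm n.+2 * sigma)%g) <->
    cqf_symmetric (path_rel sigma).
  by split; apply: eq_cqf_symmetric => i j; rewrite path_rel_rev.
split=> [H|[->|h]]; last first.
- rewrite -rev_symm; have -> : (rev_perm n.+2 * sigma)%g = 1%g.
    by apply/permP => i; rewrite permM permE h rev_ordK perm1.
  exact: path_rel1_symmetric.
- exact: path_rel1_symmetric.
case u0 : (path_up sigma 0); first by left; apply: symmetric_path_up.
(* Since the first step descends, so does the last; read from the other end the path starts
   upwards. *)
right=> i; have : (rev_perm n.+2 * sigma)%g = 1%g.
  apply: symmetric_path_up; first exact/rev_symm.
  have := path_up_step sigma (ltnSn n); rewrite /step -(symmetric_path_ends H) u0.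
  rewrite /path_up !permM !permE.
  have -> : rev_ord (inord 0 : 'I_n.+2) = inord n.+1 by apply: val_inj; rewrite /= !inordK // subn1.
  by have -> : rev_ord (inord 1 : 'I_n.+2) = inord n by apply: val_inj; rewrite /= !inordK // subn2.
move/permP/(_ (rev_ord i)); by rewrite permM permE rev_ordK perm1.
Qed.
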